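(* Let $G$ be a countable free group (of finite or countably infinite rank) and $X$ a countable discrete set. Then any action $\alpha: G \curvearrowright X$ is sofic.
   Context: For a nonempty finite set $A$, $\mathrm{Sym}(A)$ is the group of permutations of $A$, with the normalized Hamming distance $d(\sigma,\tau) = |\{a \in A : \sigma(a) \neq \tau(a)\}|/|A|$. Let $\alpha: G \curvearrowright X$ be an action of a countable discrete group on a countable discrete set, $A$ a finite set, $\varphi: G \to \mathrm{Sym}(A)$ a map (not necessarily a homomorphism). $\varphi$ is unital if $\varphi(1_G) = 1$. For finite $F \subseteq G$ and $\epsilon > 0$, $\varphi$ is $(F,\epsilon)$-multiplicative if $d(\varphi(gh), \varphi(g)\varphi(h)) < \epsilon$ for all $g,h \in F$. For finite $F \subseteq G$, finite $E \subseteq X$ and $\epsilon > 0$, $\varphi$ is an $(F,E,\epsilon)$-orbit approximation of $\alpha$ if there exist a finite set $B$ and a subset $S \subseteq A$ with $|S| > (1-\epsilon)|A|$ and, for each $s \in S$, an injective map $\pi_s: E \hookrightarrow B$, such that $\pi_{\varphi(g)s}(x) = \pi_s(\alpha(g^{-1})x)$ for all $s \in S$, $g \in F$, $x \in E$ whenever $\varphi(g)s \in S$ and $\alpha(g^{-1})x \in E$. The action $\alpha$ is sofic if for all finite $F \subseteq G$, finite $E \subseteq X$ and $\epsilon > 0$ there exist a finite set $A$ and a map $\varphi: G \to \mathrm{Sym}(A)$ which is unital, $(F,\epsilon)$-multiplicative, and an $(F,E,\epsilon)$-orbit approximation of $\alpha$. *)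

(* Defs.v *)
From mathcomp Require Export classical_sets cardinality reals.
From mathcomp Require Export all_boot all_order all_algebra all_fingroup finmap.

Set Implicit Arguments.
Unset Strict Implicit.
Unset Printing Implicit Defensive.

Import Order.TTheory GRing.Theory Num.Theory.
Local Open Scope ring_scope.

(* The universal property of the free group on the family [b]. *)
Definition free_basis (G : groupType) (I : Type) (b : I -> G) : Prop :=
  forall (H : groupType) (f : I -> H),
    exists phi : G -> H,
      [/\ monoid.monoid_morphism phi,
          forall i, phi (b i) = f i &
          forall psi : G -> H,
            monoid.monoid_morphism psi -> (forall i, psi (b i) = f i) -> psi =1 phi].

Definition free_group (G : groupType) : Prop :=
  exists (I : Type) (b : I -> G), free_basis b.

Definition left_action (G : groupType) (X : Type) (alpha : G -> X -> X) : Prop :=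
  (forall x, alpha 1%g x = x) /\
  (forall g h x, alpha (g * h)%g x = alpha g (alpha h x)).

Definition hamming (R : realType) (A : finType) (s t : {perm A}) : R :=
  #|[set a | s a != t a]|%:R / #|A|%:R.

Definition unital (G : groupType) (A : finType) (phi : G -> {perm A}) : Prop :=
  phi 1%g = 1%g.

(* In [{perm A}], [(s * t) a = t (s a)]; hence the composite of
   [phi g] after [phi h] is [phi h * phi g]. *)
Definition almost_multiplicative (R : realType) (G : groupType) (A : finType)
    (F : {fset G}) (eps : R) (phi : G -> {perm A}) : Prop :=
  forall g h, g \in F -> h \in F ->
    hamming R (phi (g * h)%g) (phi h * phi g)%g < eps.

(* The maps [pi s : E -> B] are represented by total functions on [X], of which
   only the values on [E] matter. *)
Definition orbit_approximation (R : realType) (G : groupType) (X : countType)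
    (alpha : G -> X -> X) (F : {fset G}) (E : {fset X}) (eps : R)
    (A : finType) (phi : G -> {perm A}) : Prop :=
  exists (B : finType) (S : {set A}) (pi : A -> X -> B),
    [/\ (1 - eps) * #|A|%:R < #|S|%:R,
        forall s, s \in S -> {in E &, injective (pi s)} &
        forall s g x, s \in S -> g \in F -> x \in E ->
          phi g s \in S -> alpha (g^-1)%g x \in E ->
          pi (phi g s) x = pi s (alpha (g^-1)%g x)].

Definition sofic_action (R : realType) (G : groupType) (X : countType)
    (alpha : G -> X -> X) : Prop :=
  forall (F : {fset G}) (E : {fset X}) (eps : R), 0 < eps ->
    exists (A : finType) (phi : G -> {perm A}),
      [/\ (0 < #|A|)%N,
          unital phi,
          almost_multiplicative F eps phi &
          orbit_approximation alpha F E eps phi].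

(* Main.v *)
(** Fix finite sets [F] and [E].  The identities [alpha g^-1 x = y] with [g] in
    [F] and [x], [y] in [E] only involve the partial bijections that the basis
    elements induce on some finite set [Y] containing [E].  Extending these to
    permutations of [Y] and using freeness gives an action of [G] on [Y] that
    agrees with [alpha] there.  Let [rho g] be the permutation of [Y] by which
    [g^-1] acts, let [A] be the symmetric group of [Y], and put
    [phi g s = s o rho g], [pi_s x = s x].  Then [phi] is a homomorphism and
    [pi_(phi g s) x = s (rho g x) = pi_s (alpha g^-1 x)] exactly, with
    [S = A]. *)

Require Import Defs.
From HB Require Import structures.
From mathcomp Require Import boolp.

Set Implicit Arguments.
Unset Strict Implicit.
Unset Printing Implicit Defensive.

Import GRing.Theory Num.Theory.

(** Points are treated one at a time: a transposition corrects the image of the new point, and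
    injectivity of [P] and of [s] keeps the values already prescribed. *)
Lemma perm_extension (T : finType) (P : T -> T -> Prop) :
  (forall u v v', P u v -> P u v' -> v = v') ->
  (forall u u' v, P u v -> P u' v -> u = u') ->
  exists s : {perm T}, forall u v, P u v -> s u = v.
Proof.
move=> Pfun Pinj.
suff [s sP] : exists s : {perm T},
    forall u v, u \in enum T -> P u v -> s u = v.
  by exists s => u v; apply: sP; rewrite mem_enum.
elim: (enum T) => [|a l [s sP]]; first by exists 1%g.
have [[w Paw]|nPa] := pselect (exists w, P a w); last first.
  exists s => u v; rewrite inE => /predU1P[-> Pav|]; last exact: sP.
  by case: nPa; exists v.
exists (s * tperm (s a) w)%g => u v; rewrite inE permM.
have [-> _ Pav|neq_ua /= ul Puv] := eqVneq u a.
  by rewrite tpermL (Pfun _ _ _ Paw Pav).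
rewrite -(sP _ _ ul Puv) tpermD // ?(inj_eq perm_inj) 1?eq_sym //.
apply: contra neq_ua => /eqP sw; apply/eqP/(Pinj _ _ w) => //.
by rewrite -sw (sP _ _ ul Puv).
Qed.

(* The universal property retracts [G] onto any subgroup containing the basis;
   by uniqueness this retraction is the identity. *)
Lemma free_basis_generates (G : groupType) (I : Type) (b : I -> G) (S : pred G) :
  free_basis b -> group_closed S -> (forall i, b i \in S) -> forall g, g \in S.
Proof.
move=> bfree Sgrp Sb g.
pose H : groupType := HB.pack {x : G | S x}
  (SubChoice_isSubGroup.Build G S {x : G | S x} Sgrp).
pose c i : H := Sub (b i) (Sb i).
have [r [rM rb _]] := bfree H c.
have [e [_ _ eu]] := bfree G b.
have idM : monoid.monoid_morphism (@idfun G) by [].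
have valM : monoid.monoid_morphism (fun x => \val (r x)).
  by split=> [|x y]; [rewrite rM.1 | rewrite rM.2].
have valb i : \val (r (b i)) = b i by rewrite rb.
have -> : g = \val (r g) by rewrite (eu _ valM valb) -(eu _ idM).
exact: valP.
Qed.

Local Open Scope fset_scope.

(* The action obtained from [rho] is a right action on [Y], hence the inverses:
   [rho g] models [alpha g^-1]. *)
Definition models_generators (G : groupType) (X : choiceType)
    (alpha : G -> X -> X) (I : Type) (b : I -> G) (Y : {fset X})
    (rho : G -> {perm Y}) : Prop :=
  monoid.monoid_morphism rho /\
  forall i (u v : Y), alpha (b i) (val u) = val v -> rho (b i) v = u.

Lemma models_generators_exists (G : groupType) (X : choiceType)
    (alpha : G -> X -> X) (I : Type) (b : I -> G) (Y : {fset X}) :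
  left_action alpha -> free_basis b ->
  exists rho : G -> {perm Y}, models_generators alpha b rho.
Proof.
move=> [a1 aM] bfree.
have ext i : exists s : {perm Y},
    forall v u : Y, alpha (b i) (val u) = val v -> s v = u.
  apply: perm_extension => [v u u' uv u'v|v v' u uv uv']; apply: val_inj.
    by rewrite -[val u]a1 -[val u']a1 -(mulVg (b i)) !aM uv u'v.
  by rewrite -uv -uv'.
have [f fP] := choice ext.
have [rho [rhoM rhob _]] := bfree _ f.
by exists rho; split=> // i u v /fP; rewrite rhob.
Qed.

(** The [g] that admit such a [Y0] for every [x] form a subgroup containing the basis, hence all of
    [G]. *)
Lemma models_generators_local (G : groupType) (X : choiceType)
    (alpha : G -> X -> X) (I : Type) (b : I -> G) :
  left_action alpha -> free_basis b -> forall g x,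
  exists Y0 : {fset X}, forall (Y : {fset X}) (rho : G -> {perm Y}),
    Y0 `<=` Y -> models_generators alpha b rho ->
    forall u v : Y, val u = x -> alpha (g^-1)%g x = val v -> rho g u = v.
Proof.
move=> [a1 aM] bfree.
have aVK g x : alpha g (alpha g^-1%g x) = x by rewrite -aM mulgV a1.
pose good g := forall x, exists Y0 : {fset X},
  forall (Y : {fset X}) (rho : G -> {perm Y}),
    Y0 `<=` Y -> models_generators alpha b rho ->
    forall u v : Y, val u = x -> alpha (g^-1)%g x = val v -> rho g u = v.
suff goodT : forall g, g \in [pred g | `[< good g >]] by move=> g; apply/asboolP/goodT.
apply: (free_basis_generates bfree) => [|i]; last first.
  apply/asboolP => x; exists fset0 => Y rho _ [_ rhob] u v ux vx.
  by apply: rhob; rewrite -vx aVK.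
split=> [|g h /asboolP gg /asboolP gh]; apply/asboolP => x.
  exists fset0 => Y rho _ [rhoM _] u v <-.
  by rewrite invg1 a1 rhoM.1 perm1 => /val_inj.
have [Y1 Y1P] := gg x.
(* For the factor [h^-1], the property of [h] is used at the endpoint, which [alpha h^-1] carries
   back to [alpha g^-1 x]; this intermediate point must lie in [Y]. *)
have [Y2 Y2P] := gh (alpha (g * h^-1)^-1%g x).
exists (alpha g^-1%g x |` (Y1 `|` Y2)) => Y rho.
rewrite !fsubUset fsub1set => /and3P[gxY sY1 sY2] mrho u v ux vx.
have gu : rho g u = [` gxY] by apply: Y1P.
have hv : rho h v = [` gxY].
  by apply: Y2P => //=; rewrite invgM invgK aM -aM mulVg a1.
have rhoV : rho h^-1%g = (rho h)^-1%g.
  by apply: (mulgI (rho h)); rewrite -mrho.1.2 !mulgV mrho.1.1.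
by rewrite mrho.1.2 permM gu -hv rhoV permK.
Qed.

Theorem theorem2p19 (R : realType) (G : groupType) (X : countType)
    (alpha : G -> X -> X) :
  countable [set: G]%classic -> free_group G ->
  left_action alpha -> sofic_action R alpha.
Proof.
move=> _ [I [b bfree]] act F E eps eps_gt0.
have [Yf YfP] := choice (fun p => models_generators_local act bfree p.1 p.2).
(* Finitely many pairs [(g, x)] matter, so the union of their local sets is still finite. *)
pose Y := E `|` \bigcup_(p <- [seq (g, x) | g <- F, x <- E]) Yf p.
have sEY x : x \in E -> x \in Y by move=> xE; rewrite inE xE.
have [rho mrho] := models_generators_exists Y act bfree.
have rhoE g (u v : Y) : g \in F -> val u \in E ->
    alpha g^-1%g (val u) = val v -> rho g u = v.
  move=> gF uE uv; apply: (YfP (g, val u)) => //.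
  apply: fsubset_trans (fsubsetUr _ _); apply: bigfcup_sup => //.
  exact: allpairs_f.
pose A : finType := {perm Y}.
have A_gt0 : (0 < #|A|)%N by apply/card_gt0P; exists 1%g.
pose phi g : {perm A} := perm (mulgI (rho g)).
exists A, phi; split=> //.
- by apply/permP => s; rewrite permE perm1 mrho.1.1 mul1g.
- move=> g h _ _; rewrite /hamming.
  have -> : phi (g * h)%g = (phi h * phi g)%g.
    by apply/permP => s; rewrite permM !permE mrho.1.2 mulgA.
  rewrite (_ : [set a | _] = finset.set0) ?cards0 ?mul0r //.
  by apply/setP => s; rewrite !inE eqxx.
(* [None] is only a default off [Y]; on [E], which lies in [Y], the map is [s] itself. *)
pose pi (s : A) x : option Y := omap s (insub x).
have piE s (u : Y) : pi s (val u) = Some (s u) by rewrite /pi valK.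
exists (option Y), [set: A]%SET, pi; split.
- rewrite cardsT mulrBl mul1r ltrBlDr ltrDl.
  by rewrite mulr_gt0 // ltr0n.
- move=> s _ x y /sEY xY /sEY yY.
  rewrite (piE s [` xY]) (piE s [` yY]) => -[/perm_inj].
  by move/(congr1 val).
move=> s g x _ gF xE _ gxE.
rewrite (piE _ [` sEY _ xE]) (piE _ [` sEY _ gxE]) permE permM.
by rewrite (rhoE _ _ [` sEY _ gxE]).
Qed.
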